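(* Assume separability and full support, and let $\mu$ be the group-level matching patterns of the stable outcome for surplus $\Phi$ and margins $\bm r$, and $(\bm U,\bm V)$ the solution of $\min_{\bm U,\bm V}\{G(\bm U,\bm n)+H(\bm V,\bm m):U_{xy}+V_{xy}\ge\Phi_{xy}\ \forall x,y\}$. Then: 1. $\bm U=\frac{\partial G^*}{\partial\mu}(\mu,\bm n)$ and $\bm V=\frac{\partial H^*}{\partial\mu}(\mu,\bm m)$; 2. $U_{xy}+V_{xy}=\Phi_{xy}$ for every $x\in\mathcal X,y\in\mathcal Y$, and consequently $$\Phi_{xy}=-\frac{\partial\mathcal E}{\partial\mu_{xy}}(\mu,\bm r)=\frac{\partial G_x^*}{\partial\mu_{y|x}}(\mu_{\cdot|x})+\frac{\partial H_y^*}{\partial\mu_{x|y}}(\mu_{\cdot|y}),$$ where $\mu_{y|x}=\mu_{xy}/n_x$, $\mu_{x|y}=\mu_{xy}/m_y$, $\mu_{\cdot|x}=(\mu_{y|x})_{y\in\mathcal Y}$ and $\mu_{\cdot|y}=(\mu_{x|y})_{x\in\mathcal X}$.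
   Context: Setting. $\mathcal X$ and $\mathcal Y$ are finite nonempty sets (groups of men and of women); $\mathcal X_0=\mathcal X\cup\{0\}$, $\mathcal Y_0=\mathcal Y\cup\{0\}$, where $0$ stands for singlehood. There is a continuum of men and of women: $n_x>0$ is the mass of men of group $x$, $m_y>0$ the mass of women of group $y$, and $\bm r=(\bm n,\bm m)$. Each man $i$ has a group $x_i\in\mathcal X$ and a vector $\varepsilon_i=(\varepsilon_{iy})_{y\in\mathcal Y_0}\in\mathbb R^{\mathcal Y_0}$ whose distribution among men of group $x$ is $P_x$; each woman $j$ has a group $y_j\in\mathcal Y$ and a vector $\eta_j=(\eta_{xj})_{x\in\mathcal X_0}\in\mathbb R^{\mathcal X_0}$ whose distribution among women of group $y$ is $Q_y$. Utility is perfectly transferable. Separability: there is a matrix $\Phi=(\Phi_{xy})_{x\in\mathcal X,y\in\mathcal Y}$ such that the joint surplus of a match between man $i$ and woman $j$ is $\tilde\Phi_{ij}=\Phi_{x_iy_j}+\varepsilon_{iy_j}+\eta_{x_ij}$, the utility of a single man $i$ is $\varepsilon_{i0}$ and that of a single woman $j$ is $\eta_{0j}$; moreover $\max_{y\in\mathcal Y_0}|\varepsilon_y|$ has finite expectation under each $P_x$ and $\max_{x\in\mathcal X_0}|\eta_x|$ has finite expectation under each $Q_y$. Full support: each $P_x$ has full support on $\mathbb R^{\mathcal Y_0}$ and each $Q_y$ on $\mathbb R^{\mathcal X_0}$, and all are absolutely continuous with respect to Lebesgue measure. A stable outcome is an assignment in which each individual has at most one partner, together with utilities $\tilde u_i,\tilde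 v_j$ such that $\tilde u_i\ge\varepsilon_{i0}$ with equality if $i$ is single, $\tilde v_j\ge\eta_{0j}$ with equality if $j$ is single, and $\tilde u_i+\tilde v_j\ge\tilde\Phi_{ij}$ for all $i,j$, with equality if $i$ and $j$ are matched together. At the group level a matching is $\mu=(\mu_{xy})_{x\in\mathcal X,y\in\mathcal Y}$, $\mu_{xy}$ the mass of couples formed by a man of group $x$ and a woman of group $y$. Emax functions: for $\bm U=(U_{xy})\in\mathbb R^{\mathcal X\times\mathcal Y}$ with the convention $U_{x0}=0$, $G_x(U_{x\cdot})=\mathbb E_{\varepsilon\sim P_x}\max_{y\in\mathcal Y_0}(U_{xy}+\varepsilon_y)$ and $G(\bm U,\bm n)=\sum_{x}n_xG_x(U_{x\cdot})$; for $\bm V\in\mathbb R^{\mathcal X\times\mathcal Y}$ with $V_{0y}=0$, $H_y(V_{\cdot y})=\mathbb E_{\eta\sim Q_y}\max_{x\in\mathcal X_0}(V_{xy}+\eta_x)$ and $H(\bm V,\bm m)=\sum_y m_yH_y(V_{\cdot y})$. For $\nu\in\mathbb R^{\mathcal Y}$, $G_x^*(\nu)=\sup_{U\in\mathbb R^{\mathcal Y}}(\sum_y\nu_yU_y-G_x(U))$ if $\sum_y\nu_y\le1$ and $+\infty$ otherwise; $H_y^*$ is defined symmetrically on $\mathbb R^{\mathcal X}$. Legendre–Fenchel transforms: $G^*(\mu,\bm n)=\sup_{\bm U}\left(\sum_{x,y}\mu_{xy}U_{xy}-G(\bm U,\bm n)\right)=\sum_x n_xG_x^*(\mu_{x\cdot}/n_x)$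 and $H^*(\mu,\bm m)=\sup_{\bm V}\left(\sum_{x,y}\mu_{xy}V_{xy}-H(\bm V,\bm m)\right)=\sum_ym_yH_y^*(\mu_{\cdot y}/m_y)$. The generalized entropy of matching is $\mathcal E(\mu,\bm r)=-G^*(\mu,\bm n)-H^*(\mu,\bm m)$. *)

(* Defs.v *)
From HB Require Import structures.
From mathcomp Require Import all_boot all_order all_algebra.
From mathcomp Require Import all_classical all_reals all_analysis.
Set Implicit Arguments. Unset Strict Implicit. Unset Printing Implicit Defensive.
Import Order.TTheory GRing.Theory Num.Theory.
Import numFieldNormedType.Exports.
Local Open Scope classical_set_scope.
Local Open Scope ring_scope.

Section Defs.
Variable R : realType.

(* generated by the coordinate projections (= product Borel sigma-algebra) *)
Definition coord_sets (I : finType) : set (set (I -> R)) :=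
  fun A => exists (i : I) (B : set R), measurable B /\ A = (fun e => e i) @^-1` B.

Definition vec (I : finType) := g_sigma_algebraType (@coord_sets I).

Definition obox (I : finType) (a b : I -> R) : set (vec I) :=
  [set e | forall i, a i < e i < b i].

Definition leb_null (I : finType) (A : set (vec I)) : Prop :=
  forall eps : R, 0 < eps ->
  exists a b : nat -> I -> R,
    (forall k i, a k i < b k i) /\
    A `<=` \bigcup_k obox (a k) (b k) /\
    (\sum_(0 <= k <oo) (\prod_(i : I) (b k i - a k i))%:E <= eps%:E)%E.

(* full support: every nonempty open box (a base of the topology) has positive mass *)
Definition full_support (I : finType) (P : probability (vec I) R) : Prop :=
  forall a b : I -> R, (forall i, a i < b i) -> (0 < P (obox a b))%E.

Definition abs_cont_leb (I : finType) (P : probability (vec I) R) : Prop :=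
  forall A : set (vec I), measurable A -> leb_null A -> P A = 0%E.

Definition max_abs_integrable (I : finType) (P : probability (vec I) R) : Prop :=
  P.-integrable setT (fun e : vec I => (\big[Num.max/0]_(i : I) `|e i|)%:E).

(* Index set I_0 = option I, with None standing for singlehood (U_{x0} = 0). *)
Definition emax (I : finType) (P : probability (vec (option I)) R) (W : I -> R) : R :=
  fine (\int[P]_e (\big[Num.max/e None]_(i : I) (W i + e (Some i)))%:E)%E.

Definition emax_star (I : finType) (P : probability (vec (option I)) R) (nu : I -> R)
  : \bar R :=
  if \sum_(i : I) nu i <= 1 then
    ereal_sup [set ((\sum_(i : I) nu i * W i) - emax P W)%:E | W in [set: I -> R]]
  else +oo%E.

Variables (X Y : finType).

Definition Gfun (P : X -> probability (vec (option Y)) R) (U : X -> Y -> R)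
  (n : X -> R) : R := \sum_(x : X) n x * emax (P x) (U x).

Definition Hfun (Q : Y -> probability (vec (option X)) R) (V : X -> Y -> R)
  (m : Y -> R) : R := \sum_(y : Y) m y * emax (Q y) (fun x => V x y).

Definition Gstar (P : X -> probability (vec (option Y)) R) (mu : X -> Y -> R)
  (n : X -> R) : \bar R :=
  ereal_sup [set ((\sum_(x : X) \sum_(y : Y) mu x y * U x y) - Gfun P U n)%:E
            | U in [set: X -> Y -> R]].

Definition Hstar (Q : Y -> probability (vec (option X)) R) (mu : X -> Y -> R)
  (m : Y -> R) : \bar R :=
  ereal_sup [set ((\sum_(x : X) \sum_(y : Y) mu x y * V x y) - Hfun Q V m)%:E
            | V in [set: X -> Y -> R]].

Definition entropy (P : X -> probability (vec (option Y)) R)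
  (Q : Y -> probability (vec (option X)) R) (mu : X -> Y -> R)
  (n : X -> R) (m : Y -> R) : \bar R :=
  (- Gstar P mu n - Hstar Q mu m)%E.

Definition upd1 (I : eqType) (p : I -> R) (i : I) (h : R) : I -> R :=
  fun j => p j + (if j == i then h else 0).

Definition upd2 (mu : X -> Y -> R) (x : X) (y : Y) (h : R) : X -> Y -> R :=
  fun x' y' => mu x' y' + (if (x' == x) && (y' == y) then h else 0).

Definition has_partial1 (I : eqType) (F : (I -> R) -> \bar R) (p : I -> R)
  (i : I) (d : R) : Prop :=
  (\forall h \near (0 : R), F (upd1 p i h) \is a fin_num) /\
  ((fun h : R => (fine (F (upd1 p i h)) - fine (F p)) / h) @ (0 : R)^' --> d).

Definition has_partial2 (F : (X -> Y -> R) -> \bar R) (mu : X -> Y -> R)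
  (x : X) (y : Y) (d : R) : Prop :=
  (\forall h \near (0 : R), F (upd2 mu x y h) \is a fin_num) /\
  ((fun h : R => (fine (F (upd2 mu x y h)) - fine (F mu)) / h) @ (0 : R)^' --> d).

(* A man of group x is identified with his taste vector eps : vec (option Y);
   the population of men of group x is n_x P_x, women of group y: m_y Q_y.
   An assignment is a family of measures pi x y on (men of x) * (women of y):
   the mass of couples (x,eps)-(y,eta).  Utilities u x eps, v y eta. *)
Definition stable_outcome (Phi : X -> Y -> R) (n : X -> R) (m : Y -> R)
  (P : X -> probability (vec (option Y)) R) (Q : Y -> probability (vec (option X)) R)
  (pi : X -> Y -> {measure set (vec (option Y) * vec (option X)) -> \bar R})
  (u : X -> vec (option Y) -> R) (v : Y -> vec (option X) -> R) : Prop :=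
  (* each individual has at most one partner: matched mass <= population mass *)
  (forall x (A : set (vec (option Y))), measurable A ->
     (\sum_(y : Y) pi x y (A `*` setT) <= (n x)%:E * P x A)%E) /\
  (forall y (B : set (vec (option X))), measurable B ->
     (\sum_(x : X) pi x y (setT `*` B) <= (m y)%:E * Q y B)%E) /\
  (forall x e, e None <= u x e) /\
  (forall y e, e None <= v y e) /\
  (forall x y e f, Phi x y + e (Some y) + f (Some x) <= u x e + v y f) /\
  (forall x y, {ae pi x y, forall z : vec (option Y) * vec (option X),
       u x z.1 + v y z.2 = Phi x y + z.1 (Some y) + z.2 (Some x)}) /\
  (* equality for (almost every) single man / woman: the men with u > eps_0
     are, up to a null set of singles, all matched *)
  (forall x, exists N : set (vec (option Y)), measurable N /\
      [set e | u x e != e None] `<=` N /\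
      (\sum_(y : Y) pi x y (N `*` setT) = (n x)%:E * P x N)%E) /\
  (forall y, exists N : set (vec (option X)), measurable N /\
      [set f | v y f != f None] `<=` N /\
      (\sum_(x : X) pi x y (setT `*` N) = (m y)%:E * Q y N)%E).

Definition group_matching
  (pi : X -> Y -> {measure set (vec (option Y) * vec (option X)) -> \bar R})
  : X -> Y -> R := fun x y => fine (pi x y setT).

End Defs.

(* Main.v *)
Require Import Defs.
From HB Require Import structures.
From mathcomp Require Import all_boot all_order all_algebra.
From mathcomp Require Import all_classical all_reals all_analysis.
From mathcomp Require Import measurable_realfun ring lra.
Import Order.TTheory GRing.Theory Num.Theory.
Import numFieldNormedType.Exports.
Local Open Scope classical_set_scope.
Local Open Scope ring_scope.
Set Implicit Arguments. Unset Strict Implicit. Unset Printing Implicit Defensive.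

(** From a stable outcome [(pi, u, v)] put [U'_xy = inf_e (u_x(e) - e_y)] and
    [V'_xy = inf_f (v_y(f) - f_x)]. Stability gives [U' + V' >= Phi], and on
    matched pairs every inequality is tight, so almost every matched man of group
    [x] is matched to a [y] maximising [U'_xy + e_y]. Ties being null,
    [mu_xy = n_x P_x(y is the unique best choice at U')], and likewise for women;
    full support makes [mu_xy] positive, whence [U' + V' = Phi].

    These choice probabilities are a subgradient of the Emax function at [U'].
    Full support makes it quantitative: if [|W_k - U'_k| >= d], the excess of
    [emax W] over its supporting hyperplane is at least [c |W_k - U'_k|], because a
    box of taste vectors where [k] and the outside option are almost tied changes
    its choice. Hence [(U', V')] is the unique minimiser, and [U'] maximises
    [<mu, W> - G W] sharply enough that the conjugate has partial derivative
    [U'_xy] at [mu], without any appeal to compactness or convexity. *)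

(** * Derivative of a conjugate at a sharp maximiser *)

Section ConjugateDerivative.
Variables (R : realType) (T : Type) (p k : T -> R) (W0 : T).

(* With [p W = <mu, W> - G W] and [k] a coordinate, this is the conjugate of [G]
   at [mu] moved by [h] along that coordinate. *)
Definition tilted_sup (h : R) : \bar R :=
  ereal_sup [set (p W + h * k W)%:E | W in [set: T]].

Hypothesis p_max : forall W, p W <= p W0.

Lemma tilted_sup_ge h : ((p W0 + h * k W0)%:E <= tilted_sup h)%E.
Proof. by apply: ereal_sup_ubound; exists W0. Qed.

(** Where [k W] is at least [d] away from [k W0], the loss in [p] has slope [c >= |h|] and absorbs
    the gain from the tilt; elsewhere that gain is at most [|h| * d]. *)
Lemma tilted_sup_le (d c h : R) : 0 <= d ->
  (forall W, d <= `|k W - k W0| -> c * `|k W - k W0| <= p W0 - p W) ->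
  `|h| <= c -> (tilted_sup h <= (p W0 + h * k W0 + `|h| * d)%:E)%E.
Proof.
move=> d0 gap hc; apply: ge_ereal_sup => _ [W _ <-]; rewrite lee_fin.
have hk : h * (k W - k W0) <= `|h| * `|k W - k W0|.
  by rewrite -normrM ler_norm.
have hd : 0 <= `|h| * d by rewrite mulr_ge0.
have pW := p_max W.
have [/gap|/ltW] := leP d `|k W - k W0|; set a := `|k W - k W0| in hk * => ga.
  have : `|h| * a <= c * a by rewrite ler_wpM2r // normr_ge0.
  lra.
have : `|h| * a <= `|h| * d by rewrite ler_wpM2l.
lra.
Qed.

Hypothesis p_gap : forall d : R, 0 < d -> exists2 c : R, 0 < c &
  forall W, d <= `|k W - k W0| -> c * `|k W - k W0| <= p W0 - p W.

Lemma tilted_sup_fin_num : \forall h \near (0 : R), tilted_sup h \is a fin_num.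
Proof.
have [c c0 gap] := p_gap ltr01.
have nc := @nbhs0_le _ R _ c0.
near=> h; have hc : `|h| <= c.
  by near: h; exact: nc.
have lo := tilted_sup_ge h; have hi := tilted_sup_le ler01 gap hc.
rewrite fin_numE; apply/andP; split.
  by apply: contraTneq lo => ->.
by apply: contraTneq hi => ->.
Unshelve. all: by end_near. Qed.

Lemma tilted_sup0 : tilted_sup 0 = (p W0)%:E.
Proof.
have [c c0 gap] := p_gap ltr01.
apply/eqP; rewrite eq_le; apply/andP; split.
  have := @tilted_sup_le _ _ 0 ler01 gap.
  by rewrite normr0 !mul0r !addr0; apply; exact: ltW.
by have := tilted_sup_ge 0; rewrite mul0r addr0.
Qed.

(** For small [h] the supremum lies between [p W0 + h * k W0] and that value plus [|h| * d], so the
    difference quotient is within [d] of [k W0]. Agreement near 0 is all that is asked of [F],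
    because [emax_star] jumps to [+oo] once the masses sum to more than 1. *)
Lemma tilted_sup_derivative (F : R -> \bar R) :
  (\forall h \near (0 : R), F h = tilted_sup h) ->
  (\forall h \near (0 : R), F h \is a fin_num) /\
  ((fun h : R => (fine (F h) - fine (F 0)) / h) @ (0 : R)^' --> k W0).
Proof.
move=> FE; split.
  near=> h; have -> : F h = tilted_sup h by near: h.
  by near: h; exact: tilted_sup_fin_num.
apply/cvgrPdist_le => e e0; have [c c0 gap] := p_gap e0.
have nc := @nbhs0_le _ R _ c0.
rewrite (nbhs_singleton FE) tilted_sup0 /=.
near=> h.
have h0 : h != 0 by near: h; exact: nbhs_dnbhs_neq.
have hc : `|h| <= c by near: h; apply: nbhs_dnbhs; exact: nc.
have -> : F h = tilted_sup h by near: h; exact: nbhs_dnbhs.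
have : tilted_sup h \is a fin_num.
  by near: h; apply: nbhs_dnbhs; exact: tilted_sup_fin_num.
have := tilted_sup_ge h; have := tilted_sup_le (ltW e0) gap hc.
case: (tilted_sup h) => // r; rewrite !lee_fin /= => hi lo _.
have -> : k W0 - (r - p W0) / h = (p W0 + h * k W0 - r) / h by field.
rewrite normrM normfV ler_pdivrMr ?normr_gt0// distrC ger0_norm ?subr_ge0//.
lra.
Unshelve. all: by end_near. Qed.
End ConjugateDerivative.

(** * Taste vectors *)

Section TasteVectors.
Variables (R : realType) (I : finType).
Implicit Types (e : vec R I) (P : probability (vec R I) R).

Lemma measurable_coord (i : I) : measurable_fun setT (fun e : vec R I => e i).
Proof.
move=> _ B mB; rewrite setTI.
by apply: sub_sigma_algebra; exists i, B.
Qed.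

Lemma measurable_obox (a b : I -> R) : measurable (obox a b).
Proof.
have -> : obox a b = \bigcap_(i in [set: I])
    ((fun e : vec R I => e i) @^-1` [set` `]a i, b i[]).
  apply/seteqP; split => e /= he.
    by move=> i _ /=; rewrite in_itv /= he.
  by move=> i; have := he i Logic.I; rewrite /= in_itv.
apply: fin_bigcap_measurable; first exact: finite_finset.
move=> i _; rewrite -[X in measurable X]setTI.
exact: measurable_coord.
Qed.

Lemma measurable_set_eq (f g : vec R I -> R) : measurable_fun setT f ->
  measurable_fun setT g -> measurable [set e | f e = g e].
Proof.
move=> mf mg; have -> : [set e | f e = g e] = (f \- g) @^-1` [set 0].
  by apply/seteqP; split => e /= /eqP; [|rewrite subr_eq0];
    move=> /eqP E; apply/eqP; rewrite ?subr_eq0 E.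
rewrite -[X in measurable X]setTI; apply: measurable_funB => //.
Qed.

Lemma measurable_set_lt (f g : vec R I -> R) : measurable_fun setT f ->
  measurable_fun setT g -> measurable [set e | f e < g e].
Proof.
move=> mf mg.
have : measurable (setT `&` (fun e => f e < g e) @^-1` [set true]).
  exact: measurable_fun_ltr.
by rewrite setTI.
Qed.

(* Cover by [N] boxes of side [2 s] in the coordinates [i] and [j]; their total
   volume is of order [1 / N]. The boxes of index [>= N] only fill up the
   sequence. *)
Lemma leb_null_slanted (i j : I) (c M : R) : i != j -> 0 < M ->
  leb_null [set e : vec R I | e i = c + e j /\ forall l, `|e l| < M].
Proof.
move=> ij M0 eps eps0.
have M20 : 0 < 2 * M by lra.
pose C : R := \prod_(l | (l != i) && (l != j)) (2 * M).
have C0 : 0 < C by apply: prodr_gt0.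
(* Each box will have volume [4 * s ^+ 2 * C], so [N] of them total [16 * M ^+ 2 * C / N]; this [N]
   brings the total below [eps / 2]. *)
pose N := (Num.truncn (32 * M ^+ 2 * C / eps)).+1.
have N0 : 0 < N%:R :> R by rewrite ltr0n.
have NE : 16 * M ^+ 2 * C / N%:R <= eps / 2.
  have : 32 * M ^+ 2 * C / eps < N%:R by exact: truncnS_gt.
  rewrite ltr_pdivrMr// => /ltW h; rewrite ler_pdivrMr//; lra.
pose s : R := 2 * M / N%:R.
have s0 : 0 < s by rewrite divr_gt0.
have sN : s * N%:R = 2 * M by rewrite /s divfK// gt_eqF.
pose t (k : nat) : R := - M + k%:R * s.
(* Side making the [k]-th filler box, with sides [f k], 1 and [2 * M] elsewhere, of volume
   [eps / 2 / 2 ^ k.+1]; the fillers total at most [eps / 2]. *)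
pose f (k : nat) : R := eps / 2 / (2 ^ k.+1)%:R / C.
have f0 k : 0 < f k by rewrite !divr_gt0// ltr0n expn_gt0.
pose a (k : nat) (l : I) : R :=
  if l == i then (if (k < N)%N then c + t k - s else 0)
  else if l == j then (if (k < N)%N then t k - s else 0) else - M.
pose b (k : nat) (l : I) : R :=
  if l == i then (if (k < N)%N then c + t k + s else f k)
  else if l == j then (if (k < N)%N then t k + s else 1) else M.
exists a, b; split.
  move=> k l; rewrite /a /b; have := f0 k.
  by case: ifP => _; [|case: ifP => _]; try case: ifP => _; lra.
have vol k : \prod_(l : I) (b k l - a k l) =
    if (k < N)%N then 4 * s ^+ 2 * C else eps / 2 / (2 ^ k.+1)%:R.
  have ji : j != i by rewrite eq_sym.
  rewrite (bigD1 i)//= (bigD1 j)//=.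
  rewrite (eq_bigr (fun=> 2 * M)); last first.
    by move=> l /andP[/negPf li /negPf lj]; rewrite /a /b li lj; lra.
  rewrite -/C /a /b (negPf ji) !eqxx.
  case: ifP => _; first by ring.
  by rewrite /f !subr0 mul1r divfK ?gt_eqF.
split.
  move=> e /= [eij eM].
  have /andP[lo hi] : - M < e j < M by rewrite -ltr_norml.
  pose r := (e j + M) / s.
  have r0 : 0 <= r by rewrite divr_ge0 ?(ltW s0)//; lra.
  (* [e j] lies in the half-open cell from [t k] to [t k + s]; the boxes extend by [s] on both sides
     of [t k], so that being open they still contain its left end. *)
  pose k := Num.truncn r.
  have /andP[kl kh] : k%:R <= r < k.+1%:R by exact: truncn_itv.
  have kN : (k < N)%N.
    rewrite -(ltr_nat R); apply: le_lt_trans kl _.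
    by rewrite ltr_pdivrMr// mulrC sN; lra.
  have kl' : k%:R * s <= e j + M by rewrite -ler_pdivlMr.
  have kh' : e j + M < k%:R * s + s.
    by move: kh; rewrite ltr_pdivrMr// -natr1 mulrDl mul1r.
  exists k => //= l; rewrite /a /b kN /t.
  case: eqP => [->|_]; first by rewrite eij; apply/andP; split; lra.
  case: eqP => [->|_]; first by apply/andP; split; lra.
  by rewrite -ltr_norml.
have v0 : 0 <= 4 * s ^+ 2 * C.
  by rewrite mulr_ge0 ?(ltW C0)// mulr_ge0// sqr_ge0.
have g0 k : 0 <= eps / 2 / (2 ^ k.+1)%:R.
  by rewrite divr_ge0// divr_ge0// ltW.
pose A (k : nat) : \bar R := (if (k < N)%N then 4 * s ^+ 2 * C else 0)%:E.
have A0 k : (0 <= A k)%E.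
  by rewrite lee_fin; case: ifP.
apply: (@le_trans _ _ (\sum_(0 <= k <oo)
    (A k + (eps / 2 / (2 ^ k.+1)%:R)%:E))%E).
  apply: lee_nneseries => k _.
    by rewrite lee_fin vol; case: ifP.
  rewrite vol /A -EFinD lee_fin; case: ifP => _; last by rewrite add0r.
  by rewrite lerDl.
apply: le_trans (epsilon_trick xpredT A0 _) _; first by rewrite divr_ge0// ltW.
rewrite (nneseries_split 0 N)// add0n eseries0 ?adde0; last first.
  by move=> k Nk _; rewrite /A ltnNge Nk.
rewrite (eq_big_nat _ _ (F2 := fun=> (4 * s ^+ 2 * C)%:E)); last first.
  by move=> k /andP[_ kN]; rewrite /A kN.
rewrite sumEFin -EFinD lee_fin sumr_const_nat subn0.
have -> : (4 * s ^+ 2 * C) *+ N = 16 * M ^+ 2 * C / N%:R.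
  by rewrite -mulr_natr /s; field; rewrite gt_eqF.
lra.
Qed.

(** The hyperplane is exhausted by its intersections with growing open cubes, each of which is
    Lebesgue-null. *)
Lemma abs_cont_slanted P (i j : I) (c : R) : abs_cont_leb P -> i != j ->
  P.-negligible [set e | e i = c + e j].
Proof.
move=> Pac ij.
pose F (k : nat) :=
  [set e : vec R I | e i = c + e j /\ forall l, `|e l| < k.+1%:R].
have -> : [set e | e i = c + e j] = \bigcup_k F k.
  apply/seteqP; split => [e /= eij|e [k _ [+ _]]//].
  pose B := \sum_l `|e l|.
  exists (Num.truncn B) => //=; split=> // l.
  apply: le_lt_trans (truncnS_gt B).
  by rewrite /B (bigD1 l)//= lerDl sumr_ge0.
have mF k : measurable (F k).
  have -> : F k = [set e | e i = c + e j] `&`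
      obox (fun=> - k.+1%:R) (fun=> k.+1%:R).
    by apply/seteqP; split => e /= [eij eM]; split => // l;
      have := eM l; rewrite ltr_norml.
  apply: measurableI; last exact: measurable_obox.
  apply: measurable_set_eq; first exact: measurable_coord.
  by apply: measurable_funD => //; exact: measurable_coord.
apply: negligible_bigcup => k; apply/negligibleP; first exact: mF.
by apply: Pac; [exact: mF|exact: leb_null_slanted].
Qed.

End TasteVectors.

(** * The Emax function *)

Section Emax.
Variables (R : realType) (I : finType).
Implicit Types (e : vec R (option I)) (W U : I -> R) (z : option I).

Definition util W e z : R := oapp W 0 z + e z.

Definition max_util W e : R := \big[Num.max/e None]_(i : I) (W i + e (Some i)).

Lemma util_le_max W e z : util W e z <= max_util W e.
Proof.
case: z => [i|] /=; first exact: (le_bigmax _ (fun i => W i + e (Some i))).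
by rewrite /util /= add0r; exact: bigmax_ge_id.
Qed.

Lemma max_utilP W e : exists z, max_util W e = util W e z.
Proof.
apply: (big_ind (fun r => exists z, r = util W e z)).
- by exists None; rewrite /util /= add0r.
- by move=> x y [z ->] [z' ->]; rewrite /Num.max; case: ifP => _; [exists z'|exists z].
- by move=> i _; exists (Some i).
Qed.

Definition chosen W z : set (vec R (option I)) :=
  [set e | forall z', z' != z -> util W e z' < util W e z].

Definition tied W : set (vec R (option I)) := ~` \bigcup_z chosen W z.

Lemma chosen_max W z e : chosen W z e -> max_util W e = util W e z.
Proof.
move=> ch; apply/eqP; rewrite eq_le util_le_max andbT.
have [z' ->] := max_utilP W e.
by have [->//|z'z] := eqVneq z' z; exact/ltW/ch.
Qed.

Lemma chosen_uniq W z z' e : chosen W z e -> chosen W z' e -> z = z'.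
Proof.
move=> ch ch'; apply/eqP; apply: contraT => zz'.
by have := lt_trans (ch' _ zz') (ch z' _); rewrite ltxx eq_sym; exact.
Qed.

Lemma measurable_util W z : measurable_fun setT (fun e => util W e z).
Proof. by apply: measurable_funD => //; exact: measurable_coord. Qed.

Lemma measurable_max_util W : measurable_fun setT (max_util W).
Proof.
rewrite /max_util; elim: (index_enum I) => [|i r ih].
  apply: (eq_measurable_fun (fun e : vec R (option I) => e None)).
    by move=> e _; rewrite big_nil.
  exact: measurable_coord.
apply: (eq_measurable_fun ((fun e => util W e (Some i)) \max
   (fun e => \big[Num.max/e None]_(i <- r) (W i + e (Some i))))).
  by move=> e _ /=; rewrite big_cons.
by apply: measurable_maxr => //; exact: measurable_util.
Qed.

Lemma measurable_chosen W z : measurable (chosen W z).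
Proof.
have -> : chosen W z = \bigcap_(z' in [set z' | z' != z])
    [set e | util W e z' < util W e z] by [].
apply: fin_bigcap_measurable; first exact: finite_finset.
by move=> z' _; apply: measurable_set_lt; exact: measurable_util.
Qed.

Lemma measurable_tied W : measurable (tied W).
Proof.
apply/measurableC/fin_bigcup_measurable; first exact: finite_finset.
by move=> z _; exact: measurable_chosen.
Qed.

Variable P : probability (vec R (option I)) R.

(** A tie between two best options puts [e] on one of finitely many hyperplanes; [pickle] indexes
    the pairs of options by naturals, to form a countable union. *)
Lemma tied_null W : abs_cont_leb P -> P (tied W) = 0%E.
Proof.
move=> Pac; apply: measure_negligible; first exact: measurable_tied.
pose F (n : nat) : set (vec R (option I)) :=
  if unpickle n is Some (z, z') then
    if z != z' then [set e | e z = (oapp W 0 z' - oapp W 0 z) + e z'] else set0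
  else set0.
apply: (@negligibleS _ _ _ _ (\bigcup_n F n)); last first.
  apply: negligible_bigcup => n; rewrite /F.
  case: unpickle => [[z z']|]; last exact: negligible_set0.
  by case: ifP => [zz'|_]; [exact: abs_cont_slanted|exact: negligible_set0].
move=> e te; have [z zE] := max_utilP W e.
have [z' zz' z'E] : exists2 z', z' != z & util W e z' = util W e z.
  apply: contrapT => no; apply: te; exists z => // z' zz'.
  rewrite lt_neqAle -zE util_le_max andbT; apply/eqP => E.
  by apply: no; exists z' => //; rewrite E.
exists (pickle (z, z')) => //; rewrite /F pickleK eq_sym zz' /=.
by move: z'E; rewrite /util; lra.
Qed.

Lemma normr_max_util_le W e :
  `|max_util W e| <= \big[Num.max/0]_z `|e z| + \sum_i `|W i|.
Proof.
have [z ->] := max_utilP W e; rewrite /util addrC.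
apply: le_trans (ler_normD _ _) (lerD _ _).
  exact: (le_bigmax _ (fun z => `|e z|)).
case: z => [i|] /=; last by rewrite normr0 sumr_ge0.
by rewrite (bigD1 i)//= lerDl sumr_ge0.
Qed.

Hypothesis Pint : max_abs_integrable P.

Lemma integrable_max_util W : P.-integrable setT (EFin \o max_util W).
Proof.
apply: (@le_integrable _ _ _ _ _ measurableT _
  (fun e => (\big[Num.max/0]_z `|e z| + \sum_i `|W i|)%:E)).
- by apply/measurable_EFinP; exact: measurable_max_util.
- move=> e _ /=; rewrite lee_fin (ger0_norm (x := _ + _)) ?normr_max_util_le//.
  by rewrite addr_ge0 ?sumr_ge0// bigmax_ge_id.
- apply: (eq_integrable _ ((fun e => (\big[Num.max/0]_z `|e z|)%:E) \+
     cst (\sum_i `|W i|)%:E)%E) => //.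
  by apply: integrableD => //; exact: finite_measure_integrable_cst.
Qed.

(** The index type is arbitrary, so that one simple function can combine the choice sets with extra
    sets such as [B] and [tied U]. *)
Lemma Rintegral_simple (J : Type) (r : seq J) (c : J -> R)
    (A : J -> set (vec R (option I))) :
  (forall j, measurable (A j)) ->
  P.-integrable setT (EFin \o (fun e => \sum_(j <- r) c j * \1_(A j) e)) /\
  Rintegral P setT (fun e => \sum_(j <- r) c j * \1_(A j) e) =
    \sum_(j <- r) c j * fine (P (A j)).
Proof.
move=> mA.
have iA j : P.-integrable setT (EFin \o (fun e => c j * \1_(A j) e)).
  apply: (eq_integrable _ (fun e => (c j)%:E * (\1_(A j) e)%:E)%E) => //.
  by apply: integrableZl => //; exact: integrable_indic.
elim: r => [|j r [ih1 ih2]].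
  split.
    apply: (eq_integrable _ (cst 0%E)) => //; last exact: integrable0.
    by move=> e _; rewrite /= big_nil.
  rewrite big_nil; under [X in Rintegral _ _ X]funext do rewrite big_nil.
  by rewrite Rintegral_cst// mul0r.
have E : (fun e => \sum_(j <- j :: r) c j * \1_(A j) e) =
    (fun e => c j * \1_(A j) e) \+ (fun e => \sum_(j <- r) c j * \1_(A j) e).
  by apply/funext => e; rewrite big_cons.
rewrite E big_cons; split.
  by apply: eq_integrable (integrableD measurableT (iA j) ih1).
rewrite RintegralD// ih2 RintegralZl//; last exact: integrable_indic.
by rewrite /Rintegral integral_indic// setIT.
Qed.

Definition share U z : R := fine (P (chosen U z)).

Lemma sum_option (F : option I -> R) :
  \sum_z F z = F None + \sum_i F (Some i).
Proof.
rewrite (bigD1 None)//=; congr (_ + _).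
rewrite (reindex_omap Some id) => [|[i|]]//=.
by apply: eq_bigl => i; rewrite eqxx.
Qed.

Lemma sum_chosen U (c : option I -> R) z e : chosen U z e ->
  \sum_z' c z' * \1_(chosen U z') e = c z.
Proof.
move=> ch; rewrite (bigD1 z)//= indicE mem_set// mulr1 big1 ?addr0// => z' z'z.
rewrite indicE memNset ?mulr0// => ch'.
by move: z'z; rewrite (chosen_uniq ch ch') eqxx.
Qed.

Lemma sum_share_le1 U : \sum_z share U z <= 1.
Proof.
have [iS sE] := @Rintegral_simple _ (index_enum (option I)) (fun=> 1) _
  (measurable_chosen U).
have -> : \sum_z share U z = \sum_z 1 * fine (P (chosen U z)).
  by apply: eq_bigr => z _; rewrite mul1r.
rewrite -sE [leRHS](_ : _ = Rintegral P setT (cst 1)); last first.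
  by rewrite Rintegral_cst// [X in fine X](probability_setT P) mulr1.
apply: (le_Rintegral measurableT iS).
  exact: (finite_measure_integrable_cst P 1).
move=> e _; have [[z _ ch]|no] := pselect ((\bigcup_z chosen U z) e).
  by rewrite (sum_chosen _ ch).
rewrite big1// => z _; rewrite indicE memNset ?mulr0// => ch.
by apply: no; exists z.
Qed.

Hypothesis Pac : abs_cont_leb P.

(* Keeping the choices made at [U] gives the subgradient inequality; [B] records
   where switching gains at least [a] more. Ties are absorbed by a null set. *)
Lemma emax_ge U W (a : R) (B : set (vec R (option I))) : measurable B ->
  (forall e, B e -> exists2 z, chosen U z e &
     a + (oapp W 0 z - oapp U 0 z) <= max_util W e - max_util U e) ->
  emax P U + \sum_i share U (Some i) * (W i - U i) + a * fine (P B) <=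
  emax P W.
Proof.
move=> mB hB.
(* The change in maximal utility is minorised by a simple function: [w z] on [chosen U z], an extra
   [a] on [B], and the crude bound [- C] on ties, which costs nothing in expectation. *)
pose w z := oapp W 0 z - oapp U 0 z.
pose C := \sum_z `|w z|.
have wC z : - w z <= C.
  rewrite /C (bigD1 z)//=; apply: le_trans (ler_norm _) _.
  by rewrite normrN lerDl sumr_ge0.
pose c (j : option I + bool) :=
  match j with inl z => w z | inr b => if b then a else - C end.
pose A (j : option I + bool) :=
  match j with inl z => chosen U z | inr b => if b then B else tied U end.
have mA j : measurable (A j).
  case: j => [z|[]] //=; [exact: measurable_chosen|exact: measurable_tied].
have [iS sE] := @Rintegral_simple _ (index_enum (option I + bool)%type) c _ mA.
have sumE : \sum_i share U (Some i) * (W i - U i) + a * fine (P B) =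
    \sum_j c j * fine (P (A j)).
  rewrite big_sumType/= big_bool /= (tied_null _ Pac) mulr0 addr0.
  congr (_ + _); rewrite sum_option /= /w /= subrr mul0r add0r.
  by apply: eq_bigr => i _; rewrite mulrC.
rewrite -addrA sumE -sE -[emax P U]/(Rintegral P setT (max_util U)).
rewrite -[emax P W]/(Rintegral P setT (max_util W)).
have iU := integrable_max_util U; have iW := integrable_max_util W.
rewrite -RintegralD//; apply: le_Rintegral => //.
  by apply: eq_integrable (integrableD measurableT iU iS).
move=> e _ /=; rewrite big_sumType/= big_bool /=.
rewrite -/(max_util U e) -/(max_util W e).
have wge z : chosen U z e -> w z <= max_util W e - max_util U e.
  move=> ch; have := util_le_max W e z; rewrite (chosen_max ch) /util /w; lra.
have indic1 (D : set (vec R (option I))) : D e -> \1_D e = 1 :> R.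
  by move=> De; rewrite indicE mem_set.
have indic0 (D : set (vec R (option I))) : ~ D e -> \1_D e = 0 :> R.
  by move=> De; rewrite indicE memNset.
have [[z _ ch]|no] := pselect ((\bigcup_z chosen U z) e).
  rewrite (sum_chosen _ ch) (indic0 (tied U)); last by apply; exists z.
  rewrite mulr0 addr0; have [Be|nBe] := pselect (B e).
    have [z' ch' le] := hB e Be; rewrite indic1//.
    by move: le; rewrite -(chosen_uniq ch ch') -/(w z); lra.
  by rewrite indic0// mulr0; have := wge _ ch; lra.
rewrite big1 => [|z _]; last first.
  by rewrite indic0 ?mulr0// => ch; apply: no; exists z.
rewrite (indic0 B); last by move=> /hB[z ch _]; apply: no; exists z.
rewrite (indic1 (tied U))//; have [z ->] := max_utilP U e.
have := util_le_max W e z; have := wC z; rewrite /util /w; lra.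
Qed.

Hypothesis Pfs : full_support P.

(* On this box [z] beats every other option, but [z'] by less than [d / 2]. *)
Definition near_tie_box U (d : R) z z' : set (vec R (option I)) :=
  obox (fun t => (if t == z then d / 4 else if t == z' then 0 else -1)
                 - oapp U 0 t)
       (fun t => (if t == z then d / 2 else if t == z' then d / 4 else 0)
                 - oapp U 0 t).

Lemma near_tie_box_gt0 U d z z' : 0 < d -> 0 < fine (P (near_tie_box U d z z')).
Proof.
move=> d0; have mB : measurable (near_tie_box U d z z') by exact: measurable_obox.
rewrite fine_gt0// (Pfs _)/=; last first.
  by move=> t; case: ifP => _; [|case: ifP => _]; lra.
by rewrite ltey_eq fin_num_measure.
Qed.

(** On the box the utility of [z] at [U] exceeds [d / 4], and every other one is below [d / 4]. *)
Lemma near_tie_box_chosen U d z z' : 0 < d ->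
  near_tie_box U d z z' `<=` chosen U z.
Proof.
move=> d0 e he t tz; have /andP[+ _] := he z; have /andP[_ +] := he t.
by rewrite (negPf tz) eqxx /util; case: ifP => _; lra.
Qed.

Lemma share_gt0 U z : 0 < share U z.
Proof.
apply: lt_le_trans (near_tie_box_gt0 U z z ltr01) _.
have mB : measurable (near_tie_box U 1 z z) by exact: measurable_obox.
have mC := measurable_chosen U z.
rewrite fine_le ?fin_num_measure// le_measure ?inE//.
exact: near_tie_box_chosen.
Qed.

Lemma sum_share_lt1 U : \sum_i share U (Some i) < 1.
Proof.
apply: lt_le_trans (sum_share_le1 U).
by rewrite sum_option ltrDr share_gt0.
Qed.

Lemma emax_subgradient U W :
  emax P U + \sum_i share U (Some i) * (W i - U i) <= emax P W.
Proof.
have := @emax_ge U W 0 set0 measurable0 (fun e => False_ind _).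
by rewrite mul0r addr0.
Qed.

(** If [W k] exceeds [U k] by [D >= d], types in the box that choose the outside option at [U], by
    less than [d / 2], gain at least [D / 2] by switching to [k]. If [W k] is lower, the two options
    exchange roles. The boxes depend on [d] but not on [W], hence a uniform [c]. *)
Lemma emax_gap U (k : I) (d : R) : 0 < d -> exists2 c : R, 0 < c &
  forall W, d <= `|W k - U k| -> c * `|W k - U k| <=
    emax P W - (emax P U + \sum_i share U (Some i) * (W i - U i)).
Proof.
move=> d0.
pose p z z' := fine (P (near_tie_box U d z z')).
have gap W z z' : d <= `|W k - U k| ->
    `|W k - U k| = (oapp W 0 z' - oapp U 0 z') - (oapp W 0 z - oapp U 0 z) ->
    p z z' / 2 * `|W k - U k| <=
    emax P W - (emax P U + \sum_i share U (Some i) * (W i - U i)).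
  move=> dD DE.
  have := @emax_ge U W (`|W k - U k| / 2) (near_tie_box U d z z').
  have -> : p z z' / 2 * `|W k - U k| = `|W k - U k| / 2 * p z z' by ring.
  suff H : forall e, near_tie_box U d z z' e -> exists2 z0, chosen U z0 e &
     `|W k - U k| / 2 + (oapp W 0 z0 - oapp U 0 z0) <=
      max_util W e - max_util U e.
    move=> /(_ (measurable_obox _ _) H); rewrite -/(p z z'); lra.
  move=> e he; have ch := near_tie_box_chosen d0 he.
  exists z => //; rewrite (chosen_max ch).
  have := util_le_max W e z'; have /andP[_ +] := he z; have /andP[+ _] := he z'.
  have /negPf -> : z' != z by apply/eqP => E; move: DE; rewrite E; lra.
  rewrite !eqxx /util; lra.
have p1 : 0 < p None (Some k) by exact: near_tie_box_gt0.
have p2 : 0 < p (Some k) None by exact: near_tie_box_gt0.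
exists (Num.min (p None (Some k)) (p (Some k) None) / 2).
  by rewrite divr_gt0// lt_min p1.
move=> W dD.
have [/ltW Wk|Wk] := ltP 0 (W k - U k).
  apply: le_trans (gap W None (Some k) dD _); last first.
    by rewrite ger0_norm //=; lra.
  by rewrite ler_wpM2r// ler_pM2r ?invr_gt0// ge_min lexx.
apply: le_trans (gap W (Some k) None dD _); last first.
  by rewrite ler0_norm //=; lra.
by rewrite ler_wpM2r// ler_pM2r ?invr_gt0// ge_min lexx orbT.
Qed.

End Emax.

(** * Stable outcomes *)

(** Two upper bounds whose sum is attained are both attained; nonnegativity and the finite bounds
    exclude infinite values. *)
Lemma adde_eq_le (R : realType) (a b : \bar R) (x y : R) :
  (0 <= a -> 0 <= b -> a <= x%:E -> b <= y%:E -> a + b = x%:E + y%:E ->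
  a = x%:E)%E.
Proof.
case: a b => [a| |] [b| |]//; rewrite !lee_fin => _ _ ax byy.
by rewrite -!EFinD => -[E]; congr _%:E; lra.
Qed.

(** * Matched masses as choice probabilities, for either side of the market *)

Section MatchedShare.
Variables (R : realType) (I : finType) (d : measure_display).
Variables (T : measurableType d) (pr : T -> vec R (option I)).
Variables (P : probability (vec R (option I)) R) (n : R) (U : I -> R).
Variables (pi : I -> {measure set T -> \bar R}) (N : set (vec R (option I))).

(* [chosen U (Some i)] lies inside [N], so it is entirely matched, and only [pi i]
   can charge it; conversely [pi i] lives on it up to ties. *)
Lemma matched_share : abs_cont_leb P -> measurable_fun setT pr ->
  (forall A, measurable A ->
     (\sum_i pi i (pr @^-1` A) <= n%:E * P A)%E) ->
  measurable N -> (forall e, max_util U e != e None -> N e) ->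
  (\sum_i pi i (pr @^-1` N) = n%:E * P N)%E ->
  (forall i, {ae pi i, forall t, max_util U (pr t) = util U (pr t) (Some i)}) ->
  forall i, fine (pi i setT) = n * share P U (Some i).
Proof.
move=> Pac mpr le mN hN eqN ae i.
have mpre A : measurable A -> measurable (pr @^-1` A).
  by move=> mA; rewrite -[X in measurable X]setTI; exact: mpr.
pose A := chosen U (Some i).
have mA : measurable A by exact: measurable_chosen.
have AN : N `&` A = A.
  apply/setIidPr => e ch; apply: hN; rewrite (chosen_max ch).
  by have := ch None isT; rewrite {1}/util /= add0r => /gt_eqF ->.
have PE B : measurable B -> (n%:E * P B = (n * fine (P B))%:E)%E.
  by move=> mB; rewrite EFinM fineK// fin_num_measure.
have mNA : measurable (N `\` A) by exact: measurableD.
(* The capacity bound is an equality on [N]; splitting [N] into [A] and [N \ A], each subject to its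
   own bound, forces equality on [A]. *)
have sumA : (\sum_j pi j (pr @^-1` A) = n%:E * P A)%E.
  rewrite PE//; apply: (@adde_eq_le _ _ (\sum_j pi j (pr @^-1` (N `\` A)))%E
     _ (n * fine (P (N `\` A)))); rewrite ?sume_ge0//.
  - by rewrite -PE// le.
  - by rewrite -PE// le.
  - rewrite -!PE// -big_split /=.
    transitivity (\sum_j pi j (pr @^-1` N))%E.
      apply: eq_bigr => j _.
      rewrite [in RHS](measureDI _ (mpre _ mN) (mpre _ mA)).
      by rewrite -preimage_setI AN addeC.
    rewrite eqN (measureDI _ mN mA) AN muleDr ?fin_num_adde_defl//;
      last by rewrite fin_num_measure.
    by rewrite addeC.
have piA j : j != i -> pi j (pr @^-1` A) = 0%E.
  move=> ji; apply: measure_negligible; first exact: mpre.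
  apply: negligibleS (ae j) => t /= ch E.
  have /ch : Some j != Some i by [].
  by rewrite -E (chosen_max ch) ltxx.
(* Outside [A], either [Some i] is not a best choice, which is [pi i]-null by [ae], or there is a
   tie, which is [pi i]-null because the capacity bound dominates [pi i] by a multiple of [P]. *)
have -> : pi i setT = pi i (pr @^-1` A).
  have mA' := mpre _ mA; have mcA := measurableC mA'.
  rewrite -[setT](setUv (pr @^-1` A)); apply: measureU0 => //.
  apply: measure_negligible => //.
  pose B := pr @^-1` tied U.
  have B0 : (pi i).-negligible B.
    apply/negligibleP; first by apply: mpre; exact: measurable_tied.
    apply/eqP; rewrite eq_le measure_ge0 andbT.
    rewrite -(mule0 n%:E) -(tied_null U Pac).
    apply: le_trans (le _ (measurable_tied U)).
    by rewrite (bigD1 i)//= leeDl ?sume_ge0.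
  apply: negligibleS (negligibleU (ae i) B0) => t /= nA.
  have [|nt] := pselect (tied U (pr t)); first by right.
  have [z _ ch] : (\bigcup_z chosen U z) (pr t) by exact: contrapT.
  left => /= E; apply: nA; rewrite /A /=.
  have [<-//|zi] := eqVneq z (Some i).
  have /ch : Some i != z by rewrite eq_sym.
  by rewrite -(chosen_max ch) E ltxx.
rewrite -[RHS]/(fine (n * fine (P A))%:E) -PE// -sumA (bigD1 i)//= big1 ?adde0//.
Qed.

End MatchedShare.

Section StableOutcome.
Variables (R : realType) (X Y : finType).
Variables (n : X -> R) (m : Y -> R) (Phi : X -> Y -> R).
Variables (P : X -> probability (vec R (option Y)) R).
Variables (Q : Y -> probability (vec R (option X)) R).
Variables (pi : X -> Y -> {measure set (vec R (option Y) * vec R (option X)) -> \bar R}).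
Variables (u : X -> vec R (option Y) -> R) (v : Y -> vec R (option X) -> R).
Hypothesis stab : stable_outcome Phi n m P Q pi u v.

(* The infima are finite because stability is required of every pair of types:
   any fixed partner type bounds them from below. *)
Definition men_price x y : R :=
  inf [set u x e - e (Some y) | e in [set: vec R (option Y)]].
Definition women_price x y : R :=
  inf [set v y f - f (Some x) | f in [set: vec R (option X)]].

Lemma men_price_le x y e : men_price x y <= u x e - e (Some y).
Proof.
have [_ [_ [_ [_ [blk _]]]]] := stab.
apply: ge_inf; last by exists e.
exists (Phi x y - v y (fun=> 0)) => _ [e' _ <-].
by have := blk x y e' (fun=> 0); lra.
Qed.

Lemma women_price_le x y f : women_price x y <= v y f - f (Some x).
Proof.
have [_ [_ [_ [_ [blk _]]]]] := stab.
apply: ge_inf; last by exists f.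
exists (Phi x y - u x (fun=> 0)) => _ [f' _ <-].
by have := blk x y (fun=> 0) f'; lra.
Qed.

Lemma price_feasible x y : Phi x y <= men_price x y + women_price x y.
Proof.
have [_ [_ [_ [_ [blk _]]]]] := stab.
rewrite -lerBlDr; apply: lb_le_inf.
  by exists (u x (fun=> 0) - 0); exists (fun=> 0).
move=> _ [e _ <-]; rewrite lerBlDl -lerBlDr; apply: lb_le_inf.
  by exists (v y (fun=> 0) - 0); exists (fun=> 0).
by move=> _ [f _ <-]; have := blk x y e f; lra.
Qed.

Lemma max_util_men_le x e : max_util (men_price x) e <= u x e.
Proof.
have [_ [_ [u0 _]]] := stab.
have [[y|] ->] := max_utilP (men_price x) e; rewrite /util /=.
  by have := men_price_le x y e; lra.
by rewrite add0r.
Qed.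

Lemma max_util_women_le y f : max_util (women_price^~ y) f <= v y f.
Proof.
have [_ [_ [_ [v0 _]]]] := stab.
have [[x|] ->] := max_utilP (women_price^~ y) f; rewrite /util /=.
  by have := women_price_le x y f; lra.
by rewrite add0r.
Qed.

(** The two utilities at the prices sum to at least [Phi x y] plus both tastes, that is to [u + v],
    which in turn bounds the two maximal utilities and so the two utilities themselves. The chain
    closes, so every link is an equality. *)
Lemma matched_equality x y (z : vec R (option Y) * vec R (option X)) :
  u x z.1 + v y z.2 = Phi x y + z.1 (Some y) + z.2 (Some x) ->
  [/\ max_util (men_price x) z.1 = util (men_price x) z.1 (Some y),
      max_util (women_price^~ y) z.2 = util (women_price^~ y) z.2 (Some x) &
      men_price x y + women_price x y = Phi x y].
Proof.
move=> E.
have := max_util_men_le x z.1; have := max_util_women_le y z.2.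
have := util_le_max (men_price x) z.1 (Some y).
have := util_le_max (women_price^~ y) z.2 (Some x).
have := price_feasible x y; rewrite /util /=.
by split; lra.
Qed.

Lemma men_share x y : abs_cont_leb (P x) ->
  group_matching pi x y = n x * share (P x) (men_price x) (Some y).
Proof.
have [le [_ [u0 [_ [_ [ae [sg _]]]]]]] := stab.
move=> Pac; have [N [mN [uN eqN]]] := sg x.
have preE (A : set (vec R (option Y))) :
    @fst _ (vec R (option X)) @^-1` A = A `*` setT.
  by apply/seteqP; split => z //= [].
apply: (@matched_share _ _ _ _ fst _ _ _ (pi x) N) => //.
- by move=> A mA; under eq_bigr do rewrite preE; exact: le.
(* A man with [u x e = e None] has [max_util] squeezed between [e None] and [u x e], so a different
   maximal utility forces membership in [N]. *)
- move=> e ne; apply: uN => /=; apply: contra_neq ne => ue.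
  apply/eqP; rewrite eq_le -{1}ue max_util_men_le /=.
  by have := util_le_max (men_price x) e None; rewrite /util /= add0r.
- by under eq_bigr do rewrite preE.
- move=> y'; apply: negligibleS (ae x y') => z /= nE E; apply: nE.
  by have [] := matched_equality E.
Qed.

Lemma women_share x y : abs_cont_leb (Q y) ->
  group_matching pi x y = m y * share (Q y) (women_price^~ y) (Some x).
Proof.
have [_ [le [_ [v0 [_ [ae [_ sg]]]]]]] := stab.
move=> Qac; have [N [mN [vN eqN]]] := sg y.
have preE (A : set (vec R (option X))) :
    @snd (vec R (option Y)) _ @^-1` A = setT `*` A.
  by apply/seteqP; split => z //= [].
apply: (@matched_share _ _ _ _ snd _ _ _ (pi^~ y) N) => //.
- by move=> A mA; under eq_bigr do rewrite preE; exact: le.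
- move=> f nf; apply: vN => /=; apply: contra_neq nf => vf.
  apply/eqP; rewrite eq_le -{1}vf max_util_women_le /=.
  by have := util_le_max (women_price^~ y) f None; rewrite /util /= add0r.
- by under eq_bigr do rewrite preE.
- move=> x'; apply: negligibleS (ae x' y) => z /= nE E; apply: nE.
  by have [] := matched_equality E.
Qed.

(** One matched pair with exact surplus sharing suffices; if the prices were not tight, there would
    be none and [pi x y] would vanish. *)
Lemma price_tight x y : 0 < group_matching pi x y ->
  men_price x y + women_price x y = Phi x y.
Proof.
have [_ [_ [_ [_ [_ [ae _]]]]]] := stab.
move=> mu0; apply: contrapT => ne.
have : (pi x y).-negligible setT.
  apply: negligibleS (ae x y) => z _ /= E; apply: ne.
  by have [] := matched_equality E.
move=> /(measure_negligible measurableT) E.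
by move: mu0; rewrite /group_matching E ltxx.
Qed.

End StableOutcome.

(** * Conjugates and entropy *)

Section SocialSurplus.
Variables (R : realType) (X Y : finType).
Variables (P : X -> probability (vec R (option Y)) R) (n : X -> R).
Variables (mu U : X -> Y -> R).
Hypothesis n_gt0 : forall x, 0 < n x.
Hypothesis Pint : forall x, max_abs_integrable (P x).
Hypothesis Pfs : forall x, full_support (P x).
Hypothesis Pac : forall x, abs_cont_leb (P x).
Hypothesis muE : forall x y, mu x y = n x * share (P x) (U x) (Some y).

Definition pairing (W : X -> Y -> R) : R := \sum_x \sum_y mu x y * W x y.

Lemma pairingB W W' : pairing (fun x y => W x y - W' x y) = pairing W - pairing W'.
Proof.
rewrite /pairing -sumrB; apply: eq_bigr => x _; rewrite -sumrB.
by apply: eq_bigr => y _; rewrite mulrBr.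
Qed.

Let excess W x := emax (P x) (W x) -
  (emax (P x) (U x) + \sum_y share (P x) (U x) (Some y) * (W x y - U x y)).

(** The share formula for [mu] splits the excess of [G] over its supporting hyperplane into
    nonnegative group excesses, so a gap in one group is a gap for the sum. *)
Lemma GfunB W :
  Gfun P W n - (Gfun P U n + (pairing W - pairing U)) = \sum_x n x * excess W x.
Proof.
rewrite -pairingB /Gfun /pairing -big_split /= -sumrB; apply: eq_bigr => x _.
rewrite /excess mulrBr mulrDr mulr_sumr; congr (_ - (_ + _)).
by apply: eq_bigr => y _; rewrite muE mulrA.
Qed.

Lemma Gfun_subgradient W : Gfun P U n + (pairing W - pairing U) <= Gfun P W n.
Proof.
rewrite -subr_ge0 GfunB sumr_ge0// => x _.
by rewrite mulr_ge0 ?(ltW (n_gt0 x))// subr_ge0; exact: emax_subgradient.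
Qed.

Lemma Gfun_gap x y (d : R) : 0 < d -> exists2 c : R, 0 < c &
  forall W, d <= `|W x y - U x y| -> c * `|W x y - U x y| <=
    Gfun P W n - (Gfun P U n + (pairing W - pairing U)).
Proof.
move=> d0; have [c c0 gap] := emax_gap (Pint x) (Pac x) (Pfs x) (U x) y d0.
exists (n x * c) => [|W dW]; first exact: mulr_gt0.
rewrite GfunB (bigD1 x)//= -mulrA.
apply: le_trans (_ : n x * excess W x <= _).
  by rewrite ler_pM2l//; exact: gap.
rewrite lerDl sumr_ge0// => x' _.
by rewrite mulr_ge0 ?(ltW (n_gt0 x'))// subr_ge0; exact: emax_subgradient.
Qed.

Lemma upd2_0 x y : upd2 mu x y 0 = mu.
Proof. by apply/funext => x'; apply/funext => y'; rewrite /upd2 if_same addr0. Qed.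

Lemma sum_upd2 x y h W :
  \sum_x' \sum_y' upd2 mu x y h x' y' * W x' y' = pairing W + h * W x y.
Proof.
have -> : h * W x y = \sum_x' \sum_y'
    (if (x' == x) && (y' == y) then h else 0) * W x' y'.
  rewrite (bigD1 x)//= [X in _ + X]big1 ?addr0 => [|x' /negPf xx']; last first.
    by rewrite big1// => y' _; rewrite xx' mul0r.
  rewrite (bigD1 y)//= !eqxx big1 ?addr0// => y' /negPf yy'.
  by rewrite yy' andbF mul0r.
rewrite /pairing -big_split; apply: eq_bigr => x' _ /=.
by rewrite -big_split; apply: eq_bigr => y' _ /=; rewrite mulrDl.
Qed.

Lemma Gstar_partial x y : has_partial2 (fun mu' => Gstar P mu' n) mu x y (U x y).
Proof.
have := @tilted_sup_derivative R _ (fun W => pairing W - Gfun P W n)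
  (fun W => W x y) U _ _ (fun h => Gstar P (upd2 mu x y h) n).
rewrite upd2_0; apply.
- by move=> W; have := Gfun_subgradient W; lra.
- move=> d /(Gfun_gap x y)[c c0 gap]; exists c => // W /gap; lra.
- near=> h; rewrite /Gstar /tilted_sup; congr ereal_sup.
  apply: eq_imagel => W _; congr _%:E.
  by rewrite sum_upd2; lra.
Unshelve. all: by end_near. Qed.

End SocialSurplus.

Lemma emax_star_partial (R : realType) (I : finType)
    (P : probability (vec R (option I)) R) (U : I -> R) (i : I) :
  max_abs_integrable P -> full_support P -> abs_cont_leb P ->
  has_partial1 (emax_star P) (fun j => share P U (Some j)) i (U i).
Proof.
move=> Pint Pfs Pac; pose nu j := share P U (Some j).
have sumE h : \sum_j upd1 nu i h j = \sum_j nu j + h.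
  by rewrite /upd1 big_split -big_mkcond big_pred1_eq.
have pairE h W : \sum_j upd1 nu i h j * W j = \sum_j nu j * W j + h * W i.
  under eq_bigr do rewrite mulrDl; rewrite big_split/=; congr (_ + _).
  rewrite (bigD1 i)//= eqxx big1 ?addr0// => j /negPf ->.
  by rewrite mul0r.
have diffE W : \sum_j nu j * (W j - U j) = \sum_j nu j * W j - \sum_j nu j * U j.
  by rewrite -sumrB; apply: eq_bigr => j _; rewrite mulrBr.
(* The outside option has a positive share, so for small [h] the perturbed masses still sum to at
   most 1 and [emax_star] is given by the supremum. *)
have lt1 : 0 < 1 - \sum_j nu j by rewrite subr_gt0; exact: sum_share_lt1.
have small := @nbhs0_le _ R _ lt1.
have := @tilted_sup_derivative R _ (fun W => \sum_j nu j * W j - emax P W)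
  (fun W => W i) U _ _ (fun h => emax_star P (upd1 nu i h)).
have -> : upd1 nu i 0 = nu by apply/funext => j; rewrite /upd1 if_same addr0.
apply.
- by move=> W; have := emax_subgradient Pint Pac U W; rewrite diffE; lra.
- move=> d /(emax_gap Pint Pac Pfs U i)[c c0 gap]; exists c => // W /gap.
  by rewrite diffE; lra.
- near=> h; have hle : `|h| <= 1 - \sum_j nu j by near: h; exact: small.
  rewrite /emax_star sumE ifT; last by have := ler_norm h; lra.
  rewrite /tilted_sup; congr ereal_sup.
  by apply: eq_imagel => W _; congr _%:E; rewrite pairE; lra.
Unshelve. all: by end_near. Qed.

(** Swapping the two sides of the market lets every result on [G] serve for [H]. *)
Lemma Hstar_transpose (R : realType) (X Y : finType)
    (Q : Y -> probability (vec R (option X)) R) (mu : X -> Y -> R) (m : Y -> R) :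
  Hstar Q mu m = Gstar Q (fun y x => mu x y) m.
Proof.
rewrite /Hstar /Gstar; congr ereal_sup; apply/seteqP; split => _ [W _ <-].
  by exists (fun y x => W x y) => //; rewrite exchange_big.
by exists (fun x y => W y x) => //; rewrite exchange_big.
Qed.

Lemma Hstar_partial (R : realType) (X Y : finType)
    (Q : Y -> probability (vec R (option X)) R) (mu : X -> Y -> R) (m : Y -> R)
    x y d :
  has_partial2 (fun mu' => Gstar Q mu' m) (fun y x => mu x y) y x d ->
  has_partial2 (fun mu' => Hstar Q mu' m) mu x y d.
Proof.
have E h : Hstar Q (upd2 mu x y h) m =
    Gstar Q (upd2 (fun y x => mu x y) y x h) m.
  rewrite Hstar_transpose; congr Gstar.
  by apply/funext => y'; apply/funext => x'; rewrite /upd2 andbC.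
move=> [fin lim]; split.
  by near=> h; rewrite E; near: h.
by under eq_fun do rewrite E Hstar_transpose.
Unshelve. all: by end_near. Qed.

Lemma entropy_partial (R : realType) (X Y : finType)
    (P : X -> probability (vec R (option Y)) R)
    (Q : Y -> probability (vec R (option X)) R) (mu : X -> Y -> R)
    (n : X -> R) (m : Y -> R) x y dG dH :
  has_partial2 (fun mu' => Gstar P mu' n) mu x y dG ->
  has_partial2 (fun mu' => Hstar Q mu' m) mu x y dH ->
  has_partial2 (fun mu' => entropy P Q mu' n m) mu x y (- (dG + dH)).
Proof.
move=> [finG limG] [finH limH]; split.
  near=> h; rewrite /entropy fin_numB fin_numN; apply/andP; split.
    by near: h.
  by near: h.
have E a b : a \is a fin_num -> b \is a fin_num ->
    fine (- a - b)%E = - (fine a + fine b) :> R.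
  by case: a b => [a| |] [b| |]//= _ _; lra.
(* [fine] distributes over the entropy only at finite values; this gives finiteness at [mu] itself,
   the base point of the difference quotient. *)
have fG := nbhs_singleton finG; have fH := nbhs_singleton finH.
move: fG fH; rewrite /= upd2_0 => fG fH.
have finG' : \forall h \near (0 : R)^', Gstar P (upd2 mu x y h) n \is a fin_num.
  exact: nbhs_dnbhs.
have finH' : \forall h \near (0 : R)^', Hstar Q (upd2 mu x y h) m \is a fin_num.
  exact: nbhs_dnbhs.
apply: cvg_trans (cvgN (cvgD limG limH)).
apply: near_eq_cvg; near=> h.
rewrite /entropy /= !fctE !E//; first by ring.
  by near: h.
by near: h.
Unshelve. all: by end_near. Qed.

(** * Identification of the minimiser with the stable prices *)

Unset Implicit Arguments. Set Strict Implicit. Set Printing Implicit Defensive.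

Theorem theorem4 (R : realType) (X Y : finType)
  (n : X -> R) (m : Y -> R) (Phi : X -> Y -> R)
  (P : X -> probability (vec R (option Y)) R)
  (Q : Y -> probability (vec R (option X)) R)
  (* masses *)
  (hn : forall x, 0 < n x) (hm : forall y, 0 < m y)
  (* separability: integrability of max |eps_y|, max |eta_x| *)
  (hPint : forall x, max_abs_integrable (P x))
  (hQint : forall y, max_abs_integrable (Q y))
  (* full support and absolute continuity *)
  (hPfs : forall x, full_support (P x)) (hQfs : forall y, full_support (Q y))
  (hPac : forall x, abs_cont_leb (P x)) (hQac : forall y, abs_cont_leb (Q y))
  (* a stable outcome and its group-level matching mu *)
  (pi : X -> Y -> {measure set (vec R (option Y) * vec R (option X)) -> \bar R})
  (u : X -> vec R (option Y) -> R) (v : Y -> vec R (option X) -> R)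
  (hstab : stable_outcome Phi n m P Q pi u v)
  (mu : X -> Y -> R) (hmu : mu = group_matching pi)
  (* (U,V) solves min { G(U,n) + H(V,m) : U + V >= Phi } *)
  (U V : X -> Y -> R)
  (hUVfeas : forall x y, Phi x y <= U x y + V x y)
  (hUVmin : forall U' V' : X -> Y -> R, (forall x y, Phi x y <= U' x y + V' x y) ->
     Gfun P U n + Hfun Q V m <= Gfun P U' n + Hfun Q V' m) :
  (* 1. U = dG*/dmu (mu, n),  V = dH*/dmu (mu, m) *)
  (forall x y, has_partial2 (fun mu' => Gstar P mu' n) mu x y (U x y)) /\
  (forall x y, has_partial2 (fun mu' => Hstar Q mu' m) mu x y (V x y)) /\
  (* 2. U + V = Phi, and Phi = - dE/dmu = dG_x*/dmu_{y|x} + dH_y*/dmu_{x|y} *)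
  (forall x y, U x y + V x y = Phi x y) /\
  (forall x y, has_partial2 (fun mu' => entropy P Q mu' n m) mu x y (- Phi x y)) /\
  (forall x y, exists dG dH : R,
     has_partial1 (emax_star (P x)) (fun y' => mu x y' / n x) y dG /\
     has_partial1 (emax_star (Q y)) (fun x' => mu x' y / m y) x dH /\
     Phi x y = dG + dH).
Proof.
pose U' := men_price u; pose V' := women_price v.
have muG x y : mu x y = n x * share (P x) (U' x) (Some y).
  by rewrite hmu; exact: (men_share hstab).
have muH x y : mu x y = m y * share (Q y) (V'^~ y) (Some x).
  by rewrite hmu; exact: (women_share hstab).
have mu0 x y : 0 < mu x y by rewrite muG mulr_gt0// share_gt0.
have tight x y : U' x y + V' x y = Phi x y.
  by apply: (price_tight hstab); rewrite -hmu.
pose muT y x := mu x y; pose VT y x := V x y; pose VT' y x := V' x y.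
have muHT y x : muT y x = m y * share (Q y) (VT' y) (Some x) by exact: muH.
have subG := Gfun_subgradient hn hPint hPac muG.
have subH := Gfun_subgradient hm hQint hQac muHT.
have pairT (W : X -> Y -> R) : pairing muT (fun y x => W x y) = pairing mu W.
  by rewrite /pairing exchange_big.
(* Feasibility gives [U + V >= Phi = U' + V'] entrywise, weighted here by the positive [mu]. *)
have pair_ge0 : 0 <= pairing mu U - pairing mu U' + (pairing mu V - pairing mu V').
  rewrite -!pairingB -big_split sumr_ge0// => x _.
  rewrite -big_split sumr_ge0// => y _ /=.
  rewrite -mulrDr mulr_ge0 ?(ltW (mu0 x y))//.
  by have := hUVfeas x y; have := tight x y; lra.
have opt : Gfun P U n + Gfun Q VT m <= Gfun P U' n + Gfun Q VT' m.
  by apply: hUVmin => x y; rewrite tight.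
have := subG U; have := subH VT; rewrite !pairT => sH sG.
(* Together [sG], [sH], [pair_ge0] and [opt] leave no slack in either subgradient inequality,
   whereas a differing entry would create a strict gap, taking [d] to be the size of the
   difference. *)
have UE : U = U'.
  apply/funext => x; apply/funext => y; apply: contrapT => /eqP.
  rewrite -subr_eq0 -normr_gt0 => d0.
  have [c c0 /(_ U (lexx _)) gap] := Gfun_gap hn hPint hPfs hPac muG x y d0.
  by have := mulr_gt0 c0 d0; lra.
have VE : V = V'.
  apply/funext => x; apply/funext => y; apply: contrapT => /eqP.
  rewrite -subr_eq0 -normr_gt0 => d0.
  have [c c0 /(_ VT (lexx _)) gap] := Gfun_gap hm hQint hQfs hQac muHT y x d0.
  by move: gap; rewrite !pairT; have := mulr_gt0 c0 d0; lra.
have dG x y : has_partial2 (fun mu' => Gstar P mu' n) mu x y (U x y).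
  by rewrite UE; exact: Gstar_partial.
have dH x y : has_partial2 (fun mu' => Hstar Q mu' m) mu x y (V x y).
  by rewrite VE; apply/Hstar_partial/(Gstar_partial hm hQint hQfs hQac muHT).
split; first exact: dG.
split; first exact: dH.
split=> [x y|]; first by rewrite UE VE tight.
split=> [x y|x y]; first by rewrite -tight -UE -VE; exact: entropy_partial.
exists (U x y), (V x y); split; last split.
- have -> : (fun y' => mu x y' / n x) = (fun y' => share (P x) (U x) (Some y')).
    by apply/funext => y'; rewrite muG UE mulrAC divff ?mul1r// gt_eqF.
  exact: emax_star_partial.
- have -> : (fun x' => mu x' y / m y) = (fun x' => share (Q y) (V^~ y) (Some x')).
    by apply/funext => x'; rewrite muH VE mulrAC divff ?mul1r// gt_eqF.
  exact: (@emax_star_partial _ _ _ (V^~ y)).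
- by rewrite UE VE tight.
Qed.
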